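(* Let $\mathcal I$ be a translation invariant free ideal of $\mathbb N$. For $\mathbf u\in\mathcal A$ consider the statement $$E(\mathbf u):\quad\text{for every }x\in[0,1),\text{ if } \operatorname{supp}(x)+1\subseteq^{\mathcal I}\operatorname{supp}(x)\text{ and }\operatorname{supp}_b(x)\subseteq_{\mathcal I}\operatorname{supp}(x),\text{ then }\bar x\in t_{\mathbf u}^{\mathcal I}(\mathbb T),$$ where $\operatorname{supp}$ and $\operatorname{supp}_b$ are taken with respect to $\mathbf u$. Then the following conditions are equivalent: (1) $\mathcal I$ is nested; (2) $E(\mathbf u)$ holds for every $\mathbf u\in\mathcal A$; (3) $E(\mathbf u)$ holds for every $b$-bounded $\mathbf u\in\mathcal A$; (4) $E(\mathbf u)$ holds for $\mathbf u=(2^n)_{n\in\mathbb N}\in\mathcal A$; (5) there exists a $b$-bounded $\mathbf u\in\mathcal A$ such that $E(\mathbf u)$ holds.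
   Context: $\mathbb N=\{0,1,2,\dots\}$, $\mathbb N_+=\mathbb N\setminus\{0\}$, $\mathbb T=\mathbb R/\mathbb Z$ is the circle group, and $\bar x$ is the image of $x\in\mathbb R$ in $\mathbb T$. $\mathcal A$ is the family of arithmetic sequences: strictly increasing sequences of integers $\mathbf u=(u_n)_{n\in\mathbb N}$ with $u_0=1$ and $u_n\mid u_{n+1}$ for all $n$. Put $b_n=u_n/u_{n-1}$ for $n\in\mathbb N_+$; $\mathbf u$ is $b$-bounded if $(b_n)_{n\in\mathbb N_+}$ is bounded. Given $\mathbf u$, every $x\in[0,1)$ has a unique representation $x=\sum_{n=1}^\infty c_n/u_n$ with $c_n\in\mathbb N$, $c_n<b_n$ for all $n\in\mathbb N_+$, and $c_n<b_n-1$ for infinitely many $n$; $\operatorname{supp}(x)=\{n\in\mathbb N_+:c_n\ne0\}$, $\operatorname{supp}_b(x)=\{n\in\mathbb N_+:c_n=b_n-1\}$. For $A\subseteq\mathbb N$ and $k\in\mathbb Z$, $A+k$ denotes $\{a+k:a\in A\}\cap\mathbb N$. An ideal $\mathcal I$ of $\mathbb N$ is a non-empty family of subsets of $\mathbb N$ closed under finite unions and subsets (not required to be proper); it is free if it contains all finite sets; it is translation invariant if $A\in\mathcal I$ implies $A+k\in\mathcal I$ for all $k\in\mathbb Z$. Write $A\subseteq^{\mathcal I}B$ if $A\setminus B\in\mathcal I$, and $A\subseteq_{\mathcal I}B$ if $A\subseteq B$ and $B\setminus A\in\mathcal I$. A pair $((l_n)_{n\in\mathbb N},(r_n)_{n\in\mathbb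 N})$ of strictly increasing sequences in $\mathbb N$ is left nested if $l_n\le r_n<l_{n+1}-1$ for every $n\in\mathbb N$. A free ideal $\mathcal I$ of $\mathbb N$ is nested if for every left nested pair $((l_n),(r_n))$, $\{r_n:n\in\mathbb N\}\in\mathcal I$ implies $\{l_n:n\in\mathbb N\}\in\mathcal I$. $t_{\mathbf u}^{\mathcal I}(\mathbb T)$ is the set of $z\in\mathbb T$ such that $\{n\in\mathbb N:u_nz\notin U\}\in\mathcal I$ for every neighborhood $U$ of $0$ in $\mathbb T$. *)

(* Defs.v *)
From HB Require Import structures.
From mathcomp Require Import all_boot all_order all_algebra.
From mathcomp Require Import all_classical all_reals all_analysis.

Set Implicit Arguments.
Unset Strict Implicit.
Unset Printing Implicit Defensive.

Import Order.TTheory GRing.Theory Num.Theory.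
Import numFieldNormedType.Exports.

Local Open Scope classical_set_scope.
Local Open Scope ring_scope.
Local Open Scope quotient_scope.

(* The subgroup Num.int of R, as a bundled predicate. *)
Definition integers (R : realType) : zmodClosed R :=
  GRing.ZmodClosed.clone R (@Num.int_num_subdef R) _.

(* The topological group R/Z: the Z-module quotient of R by its subgroup of
   integers, with the quotient topology. *)
Definition circle (R : realType) : Type :=
  quotient_topology (Quotient.quot (integers R)).

HB.instance Definition _ (R : realType) := Topological.on (circle R).
(* The group law is that of the quotient module. It is rebuilt rather than
   copied because the two library quotients carry different
   Choice structures, which would block the joint structure. *)
HB.instance Definition _ (R : realType) :=
  let Q := Quotient.quot (integers R) : zmodType in
  GRing.isZmodule.Build (circle R) (@addrA Q) (@addrC Q) (@add0r Q) (@addNr Q).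

Definition circle_pi (R : realType) (x : R) : circle R :=
  \pi_(Quotient.quot (integers R)) x.

(* The terms of an arithmetic sequence are positive, because u 0 = 1 and u is
   increasing; they are therefore taken in nat. *)
Definition arithmetic_seq (u : nat -> nat) : Prop :=
  [/\ {homo u : m n / (m < n)%N}, u 0 = 1%N & forall n, (u n %| u n.+1)%N].

(* Meaningful for n > 0 only; the value at 0 is never used. *)
Definition ratio (u : nat -> nat) (n : nat) : nat := (u n %/ u n.-1)%N.

Definition b_bounded (u : nat -> nat) : Prop :=
  exists M : nat, forall n, (0 < n)%N -> (ratio u n <= M)%N.

(* The digits are indexed by the positive integers; c 0 is unconstrained. *)
Definition representation (R : realType) (u : nat -> nat) (x : R)
    (c : nat -> nat) : Prop :=
  [/\ forall n, (0 < n)%N -> (c n < ratio u n)%N,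
      infinite_set [set n | (0 < n)%N /\ (c n < ratio u n - 1)%N] &
      (fun N => \sum_(1 <= n < N.+1) ((c n)%:R / (u n)%:R : R)) @ \oo --> x].

(* For u arithmetic and 0 <= x < 1 the representation exists, and it is unique
   on the positive indices; the default value matters only outside this case. *)
Definition digits (R : realType) (u : nat -> nat) (x : R) : nat -> nat :=
  xget (fun=> 0%N) [set c | representation u x c].

Definition supp (R : realType) (u : nat -> nat) (x : R) : set nat :=
  [set n | (0 < n)%N /\ digits u x n <> 0%N].

Definition supp_b (R : realType) (u : nat -> nat) (x : R) : set nat :=
  [set n | (0 < n)%N /\ digits u x n = (ratio u n - 1)%N].

Definition translate (A : set nat) (k : int) : set nat :=
  [set m : nat | exists2 a : nat, A a & m%:Z = a%:Z + k].

(* An ideal need not be proper. *)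
Definition ideal (I : set (set nat)) : Prop :=
  [/\ I !=set0,
      forall A B, I A -> I B -> I (A `|` B) &
      forall A B, A `<=` B -> I B -> I A].

Definition free_ideal (I : set (set nat)) : Prop :=
  ideal I /\ forall A, finite_set A -> I A.

Definition translation_invariant (I : set (set nat)) : Prop :=
  forall A (k : int), I A -> I (translate A k).

Definition almost_sub (I : set (set nat)) (A B : set nat) : Prop :=
  I (A `\` B).

Definition sub_almost_eq (I : set (set nat)) (A B : set nat) : Prop :=
  A `<=` B /\ I (B `\` A).

Definition left_nested (l r : nat -> nat) : Prop :=
  [/\ {homo l : m n / (m < n)%N}, {homo r : m n / (m < n)%N} &
      forall n, (l n <= r n)%N /\ (r n < l n.+1 - 1)%N].

Definition nested (I : set (set nat)) : Prop :=
  forall l r, left_nested l r -> I (range r) -> I (range l).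

(* The I-characterized subgroup of the circle determined by u. *)
Definition characterized (R : realType) (I : set (set nat)) (u : nat -> nat) :
    set (circle R) :=
  [set z | forall U : set (circle R), nbhs (0 : circle R) U ->
             I [set n | ~ U (z *+ u n)]].

Definition supp_criterion (R : realType) (I : set (set nat))
    (u : nat -> nat) : Prop :=
  forall x : R, 0 <= x < 1 ->
    almost_sub I (translate (supp u x) 1) (supp u x) ->
    sub_almost_eq I (supp_b u x) (supp u x) ->
    characterized I u (circle_pi x).

(* Main.v *)
(* For [x] with digits [c], the fractional parts [f n] of [u n x] satisfy
   [f n * b (n + 1) = c (n + 1) + f (n + 1)]. This determines the digits, and it
   shows that [f n] is within [2 ^- m] of 0 (resp. of 1) when the digits
   [n + 1, ..., n + m] all vanish (resp. are all maximal). If [x] satisfies the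
   support conditions, the right ends of the maximal intervals of its support
   form a set of the ideal, hence so do the left ends when the ideal is nested;
   away from finitely many translates of these two sets and of the non-maximal
   digits, long runs of digits are all zero or all maximal, so [u n x] is close
   to 0 modulo 1. Conversely, given a left nested pair, take for [x] the number
   with maximal digits on the intervals [[l k, r k]] and zeros elsewhere: just
   before [l k], [u n x] stays away from 0 modulo 1. *)
Require Import Defs.
From mathcomp Require Import all_boot all_order all_algebra.
From mathcomp Require Import all_classical all_reals all_analysis.
From mathcomp Require Import zify ring lra.
(* Again, since mathcomp.algebra.fraction also defines [ratio]. *)
Require Import Defs.

Set Implicit Arguments.
Unset Strict Implicit.
Unset Printing Implicit Defensive.

Import Order.TTheory GRing.Theory Num.Theory.
Import numFieldNormedType.Exports.

Local Open Scope classical_set_scope.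
Local Open Scope ring_scope.

(** * The circle, and characterized subgroups through fractional parts *)

Lemma circle_pi_eq (R : realType) (x y : R) :
  circle_pi x = circle_pi y <-> x - y \is a Num.int.
Proof.
have -> : (x - y \is a Num.int) = (x - y \in integers R) by [].
rewrite Quotient.idealrBE; split=> [xy|/eqP //].
exact/eqP.
Qed.

Lemma circle_piMn (R : realType) (x : R) n :
  circle_pi (x *+ n) = circle_pi x *+ n :> circle R.
Proof.
elim: n => [|n IHn]; first by rewrite !mulr0n /circle_pi raddf0.
by rewrite !mulrS -IHn /circle_pi raddfD.
Qed.

Lemma circle_pi_continuous (R : realType) :
  continuous (@circle_pi R : R -> circle R).
Proof. exact: pi_continuous. Qed.

Lemma circle_pi_ball_nbhs (R : realType) (e : R) : 0 < e ->
  nbhs (0 : circle R) [set z | exists2 y : R, `|y| < e & z = circle_pi y].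
Proof.
move=> e0; apply: open_nbhs_nbhs; split; last first.
  by exists 0; rewrite ?normr0// /circle_pi raddf0.
(* Openness in the quotient topology is by definition openness of the preimage in [R], here a union
   of integer translates of a ball. *)
change (open [set x : R | exists2 y : R, `|y| < e & circle_pi x = circle_pi y]).
rewrite openE => x [y ye /circle_pi_eq xy]; apply/nbhs_ballP.
exists (e - `|y|); first by rewrite /= subr_gt0.
move=> z; rewrite /ball /= => xz; exists (z - x + y).
  rewrite (le_lt_trans (ler_normD _ _))// -ltrBrDr distrC //.
by apply/circle_pi_eq; rewrite (_ : _ - _ = x - y) //; ring.
Qed.

(** The fractional part of [x * u n] when [0 <= x], where [Num.truncn] is the floor. *)
Definition frac_mul {R : realType} (u : nat -> nat) (x : R) (n : nat) : R :=
  x * (u n)%:R - (Num.truncn (x * (u n)%:R))%:R.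

Lemma frac_mul_itv (R : realType) u (x : R) n :
  0 <= x -> 0 <= frac_mul u x n < 1.
Proof.
move=> x0; have /truncn_itv : 0 <= x * (u n)%:R by rewrite mulr_ge0.
by rewrite /frac_mul -natr1; lra.
Qed.

Lemma circle_pi_frac_mul (R : realType) u (x : R) n :
  circle_pi (frac_mul u x n) = circle_pi x *+ u n :> circle R.
Proof.
rewrite -circle_piMn -[x *+ _]mulr_natr; apply/circle_pi_eq.
by rewrite /frac_mul addrC addKr rpredN natr_int.
Qed.

(** Images of balls around 0 form a neighborhood base of 0 in the circle, and a representative in
    [0, 1) lies in the image of the [e]-ball only if it is within [e] of 0 or of 1. *)
Lemma characterizedP (R : realType) I u (x : R) : ideal I -> 0 <= x ->
  characterized I u (circle_pi x) <->
  forall e : R, 0 < e -> I [set n | e <= frac_mul u x n <= 1 - e].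
Proof.
move=> [_ _ Isub] x0; split => [charx e e0|fracx U].
  have := charx _ (circle_pi_ball_nbhs e0).
  apply: Isub => n /= en [y].
  rewrite -circle_pi_frac_mul ltr_norml => ye.
  move=> /circle_pi_eq /intrP [k] ky.
  (* The two bounds put an integer strictly between 0 and 1. *)
  have : 0 < (k%:~R : R) < 1 by rewrite -ky; lra.
  by rewrite ltr0z -[1]/(1%:~R) ltr_int; lia.
have <- : circle_pi 0 = 0 :> circle R by rewrite /circle_pi raddf0.
move=> /circle_pi_continuous /nbhs_ballP [e /= e0 eU].
apply: Isub (fracx _ e0) => n /= NU.
rewrite !leNgt -negb_or; apply/negP => /orP fe; apply: NU.
have := frac_mul_itv u n x0; rewrite -circle_pi_frac_mul => fi.
case: fe => fe; first by apply: eU; rewrite /ball /= sub0r normrN ltr_norml; lra.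
(* Near 1, the representative shifted by -1 is the one close to 0. *)
have <- : circle_pi (frac_mul u x n - 1) = circle_pi (frac_mul u x n).
  by apply/circle_pi_eq; rewrite addrC addKr rpredN1.
by apply: eU; rewrite /ball /= sub0r normrN ltr_norml; lra.
Qed.

(** * Arithmetic sequences and digit expansions *)

Lemma infinite_natP (A : set nat) :
  infinite_set A <-> forall n, exists2 m, (n <= m)%N & A m.
Proof.
split=> [Ainf n|Aunb /finite_seqP [s As]].
  apply: contrapT => nex; apply: Ainf.
  apply: (sub_finite_set _ (finite_II n)) => m Am /=.
  by rewrite ltnNge; apply/negP => nm; apply: nex; exists m.
have [m sm] := Aunb (\max_(i <- s) i).+1.
by rewrite As /= => ms; have := @leq_bigmax_seq _ _ xpredT id m ms isT; rewrite leqNgt sm.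
Qed.

Section arithmetic.
Variable u : nat -> nat.
Hypothesis arith_u : arithmetic_seq u.

Lemma arithmetic_seq_gt n : (n < u n)%N.
Proof.
have [um u0 _] := arith_u; elim: n => [|n IHn]; first by rewrite u0.
exact: leq_ltn_trans IHn (um _ _ (ltnSn n)).
Qed.

Lemma arithmetic_seqS n : u n.+1 = (u n * ratio u n.+1)%N.
Proof. by have [_ _ ud] := arith_u; rewrite /ratio /= mulnC divnK. Qed.

Lemma ratio_gt1 n : (1 < ratio u n.+1)%N.
Proof.
have [um _ _] := arith_u; have := um _ _ (ltnSn n).
by rewrite arithmetic_seqS -[ltnLHS]muln1 ltn_mul2l => /andP[].
Qed.

End arithmetic.

Section expansion.
Variables (R : realType) (u : nat -> nat) (x : R).
Hypothesis arith_u : arithmetic_seq u.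

Let ugt0 n : 0 < ((u n)%:R : R).
Proof. by rewrite ltr0n (leq_ltn_trans _ (arithmetic_seq_gt arith_u n)). Qed.

Let uS n : ((u n.+1)%:R : R) = (u n)%:R * (ratio u n.+1)%:R.
Proof. by rewrite (arithmetic_seqS arith_u) natrM. Qed.

Let bgt0 n : 0 < ((ratio u n.+1)%:R : R).
Proof. by rewrite ltr0n (ltn_trans _ (ratio_gt1 arith_u n)). Qed.

Definition partial_sum (c : nat -> nat) (N : nat) : R :=
  \sum_(1 <= n < N.+1) ((c n)%:R / (u n)%:R : R).

Lemma partial_sumS c N :
  partial_sum c N.+1 = partial_sum c N + (c N.+1)%:R / (u N.+1)%:R.
Proof. by rewrite /partial_sum big_nat_recr. Qed.

Lemma partial_sum_nondecreasing c :
  {homo partial_sum c : m n / (m <= n)%N >-> m <= n}.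
Proof.
apply/nondecreasing_seqP => n.
by rewrite partial_sumS lerDl divr_ge0// ltW.
Qed.

(** Every [u n] with [n <= N] divides [u N], which clears all denominators. *)
Lemma partial_sum_natr c N : exists k, partial_sum c N * (u N)%:R = k%:R.
Proof.
elim: N => [|N [k IHN]].
  by exists 0%N; rewrite /partial_sum big_geq// mul0r.
exists (k * ratio u N.+1 + c N.+1)%N.
rewrite partial_sumS mulrDl divfK ?gt_eqF// uS mulrA IHN.
by rewrite natrD natrM.
Qed.

Section bounded_digits.
Variable c : nat -> nat.
Hypothesis c_lt : forall n, (0 < n)%N -> (c n < ratio u n)%N.

(** The value reached when all digits after [N] are maximal: their contributions telescope to
    [1 / u N]. *)
Definition upper_sum N := partial_sum c N + (u N)%:R^-1.

Lemma upper_sumS N : upper_sum N.+1 =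
  upper_sum N - (ratio u N.+1 - 1 - c N.+1)%:R / (u N.+1)%:R.
Proof.
have b1 := ratio_gt1 arith_u N; have cb := c_lt (ltn0Sn N).
rewrite /upper_sum partial_sumS -subnDA natrB; last lia.
rewrite natrD uS; move: (bgt0 N); move: (ratio _ _)%:R => b b0; field.
by rewrite !gt_eqF.
Qed.

Lemma upper_sum_nonincreasing :
  {homo upper_sum : m n / (m <= n)%N >-> n <= m}.
Proof.
apply/nonincreasing_seqP => n.
by rewrite upper_sumS gerBl divr_ge0// ltW.
Qed.

Lemma partial_sum_le_upper M N : partial_sum c M <= upper_sum N.
Proof.
apply: (@le_trans _ _ (partial_sum c (maxn M N))).
  by apply: partial_sum_nondecreasing; rewrite leq_maxl.
apply: (@le_trans _ _ (upper_sum (maxn M N))).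
  by rewrite /upper_sum lerDl invr_ge0 ltW.
by apply: upper_sum_nonincreasing; rewrite leq_maxr.
Qed.

End bounded_digits.

Lemma representation_itv c N : representation u x c ->
  partial_sum c N <= x < partial_sum c N + (u N)%:R^-1.
Proof.
move=> [c_lt /infinite_natP cinf cx]; rewrite -/(upper_sum c N).
have cvgx : cvgn (partial_sum c) by apply/cvg_ex; exists x.
have limx : limn (partial_sum c) = x by apply/cvg_lim.
apply/andP; split.
  rewrite -limx; apply: nondecreasing_cvgn_le cvgx _.
  exact: partial_sum_nondecreasing.
(* At a non-maximal digit beyond [N], [upper_sum] drops strictly; this makes the upper bound on [x]
   strict. *)
have [[|m] Nm [// _ cm]] := cinf N.+1.
apply: (@le_lt_trans _ _ (upper_sum c m.+1)).
  rewrite -limx; apply: limr_le cvgx _.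
  by apply: nearW => M; exact: partial_sum_le_upper.
apply: (@lt_le_trans _ _ (upper_sum c m)); last exact: upper_sum_nonincreasing.
by rewrite upper_sumS// gtrBl divr_gt0// ltr0n subn_gt0.
Qed.

Lemma representation_truncn c N : representation u x c ->
  (Num.truncn (x * (u N)%:R))%:R = partial_sum c N * (u N)%:R.
Proof.
move=> /representation_itv-/(_ N).
have [k kE] := partial_sum_natr c N => /andP[lo hi].
rewrite kE; congr (_%:R); apply: truncn_def.
rewrite -natr1 -kE ler_pM2r// lo /=.
by rewrite -ltr_pdivlMr// mulrDl mulfK ?gt_eqF// mul1r.
Qed.

(** A limit-free form of [representation], equivalent to it for [0 <= x < 1]. *)
Definition digit_recurrence (c : nat -> nat) : Prop := forall n,
  frac_mul u x n * (ratio u n.+1)%:R = (c n.+1)%:R + frac_mul u x n.+1.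

Lemma representation_recurrence c :
  representation u x c -> digit_recurrence c.
Proof.
move=> cx n; rewrite /frac_mul !(representation_truncn _ cx) partial_sumS.
rewrite uS; move: (bgt0 n); move: (ratio _ _)%:R => b b0; field.
by rewrite !gt_eqF.
Qed.

Hypothesis x0 : 0 <= x.

Lemma digit_recurrence_zeros c n m : digit_recurrence c ->
  (forall i, (n < i <= n + m)%N -> c i = 0%N) ->
  frac_mul u x n * 2 ^+ m <= 1.
Proof.
move=> crec c0; suff : frac_mul u x n * 2 ^+ m <= frac_mul u x (n + m).
  by have := frac_mul_itv u (n + m) x0; lra.
elim: m c0 => [|m IHm] c0; first by rewrite addn0 expr0 mulr1.
have {}IHm := IHm (fun i ni => c0 i (ltac:(lia))).
have := crec (n + m)%N; rewrite c0 ?add0r -?addnS; last lia.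
move=> <-; rewrite exprSr mulrA.
apply: ler_pM => //; last by rewrite ler_nat addnS ratio_gt1.
by rewrite mulr_ge0// ?exprn_ge0//; have := frac_mul_itv u n x0; lra.
Qed.

(** At a maximal digit, [1 - frac_mul u x n] is multiplied by the ratio, just as [frac_mul u x n] is
    at a zero digit. *)
Lemma digit_recurrence_maxs c n m : digit_recurrence c ->
  (forall i, (n < i <= n + m)%N -> c i = (ratio u i - 1)%N) ->
  (1 - frac_mul u x n) * 2 ^+ m <= 1.
Proof.
move=> crec c1.
suff : (1 - frac_mul u x n) * 2 ^+ m <= 1 - frac_mul u x (n + m).
  by have := frac_mul_itv u (n + m) x0; lra.
elim: m c1 => [|m IHm] c1; first by rewrite addn0 expr0 mulr1.
have {}IHm := IHm (fun i ni => c1 i (ltac:(lia))).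
have b1 := ratio_gt1 arith_u (n + m).
have := crec (n + m)%N; rewrite c1 -?addnS; last lia.
rewrite natrB; last by rewrite addnS ltnW.
move=> fE; have {fE} -> : 1 - frac_mul u x (n + m.+1) =
  (1 - frac_mul u x (n + m)) * (ratio u (n + m.+1))%:R by lra.
rewrite exprSr mulrA.
apply: ler_pM => //; last by rewrite ler_nat addnS.
by rewrite mulr_ge0// ?exprn_ge0//; have := frac_mul_itv u n x0; lra.
Qed.

Lemma recurrence_representation c : x < 1 ->
  digit_recurrence c -> representation u x c.
Proof.
move=> x1 crec; have [_ u0 _] := arith_u; have fi n := frac_mul_itv u n x0.
have c_lt n : (0 < n)%N -> (c n < ratio u n)%N.
  case: n => // n _; have := crec n; have := fi n; have := fi n.+1.
  move=> /andP[f0 _] /andP[_ f1] cE; rewrite -(ltr_nat R).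
  by have := bgt0 n; nra.
split=> //.
  (* If all digits after [n] were maximal, [1 - frac_mul u x n] would be positive yet at most
     [2 ^- m] for every [m]. *)
  apply/infinite_natP => n; apply: contrapT => nex.
  have cmax m i : (n < i <= n + m)%N -> c i = (ratio u i - 1)%N.
    move=> ni; have := c_lt i; apply: contra_notP nex => ci.
    by exists i; [lia | split; lia].
  have := fi n => /andP[_ f1].
  have e0 : 0 < 1 - frac_mul u x n by rewrite subr_gt0.
  have := upper_nthrootP (leqnn (Num.bound (1 - frac_mul u x n)^-1)).
  rewrite -[ltLHS]mul1r ltr_pdivrMr// ltNge mulrC.
  by rewrite (digit_recurrence_maxs crec (cmax _)).
have sumE N : partial_sum c N = x - frac_mul u x N / (u N)%:R.
  elim: N => [|N IHN].
    rewrite /partial_sum big_geq// /frac_mul u0 mulr1 divr1.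
    by rewrite (@truncn_def _ x 0) ?x0//; ring.
  rewrite partial_sumS IHN -[(c _)%:R](addrK (frac_mul u x N.+1)) -crec uS.
  by move: (bgt0 N); move: (ratio _ _)%:R => b b0; field; rewrite !gt_eqF.
apply/cvgrPdist_lt => e e0; near=> N.
rewrite -/(partial_sum c N) sumE opprB addrC subrK.
have /andP[f0 f1] := fi N.
rewrite ger0_norm ?divr_ge0// ltr_pdivrMr// (lt_trans f1)//.
rewrite mulrC -ltr_pdivrMr// div1r (@le_lt_trans _ _ (N%:R : R))//.
  by near: N; exact: nbhs_infty_ger.
by rewrite ltr_nat arithmetic_seq_gt.
Unshelve. all: by end_near. Qed.

Lemma representation_exists : x < 1 -> exists c, representation u x c.
Proof.
(* The greedy digits: integer parts of the rescaled fractional parts. *)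
move=> x1; exists (fun n => Num.truncn (frac_mul u x n.-1 * (ratio u n)%:R)).
apply: recurrence_representation => // n /=.
have /andP[f0 _] := frac_mul_itv u n x0.
have /truncn_itv : 0 <= frac_mul u x n * (ratio u n.+1)%:R by rewrite mulr_ge0.
set d := Num.truncn _ => dE.
rewrite {2}/frac_mul.
have xE : x * (u n.+1)%:R = (Num.truncn (x * (u n)%:R) * ratio u n.+1)%:R +
    frac_mul u x n * (ratio u n.+1)%:R.
  by rewrite /frac_mul uS natrM; ring.
rewrite (@truncn_def _ _ (Num.truncn (x * (u n)%:R) * ratio u n.+1 + d)).
  by rewrite xE natrD; ring.
by rewrite xE -addnS !natrD lerD2l ltrD2l.
Qed.

Lemma digits_representation : x < 1 -> representation u x (digits u x).
Proof. by move=> /representation_exists /(xgetPex (fun=> 0%N)). Qed.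

(** The recurrence expresses each digit through fractional parts that depend on [x] alone. *)
Lemma digits_unique c n :
  representation u x c -> (0 < n)%N -> digits u x n = c n.
Proof.
case: n => // n cx _; have dx : representation u x (digits u x).
  by apply: (xgetPex (fun=> 0%N)); exists c.
apply/eqP; rewrite -(eqr_nat R); apply/eqP.
apply: (addIr (frac_mul u x n.+1)).
by rewrite -(representation_recurrence dx) -(representation_recurrence cx).
Qed.

End expansion.

Lemma representation_of_digits (R : realType) u (c : nat -> nat) :
  arithmetic_seq u -> (forall n, (0 < n)%N -> (c n < ratio u n)%N) ->
  infinite_set [set n | (0 < n)%N /\ (c n < ratio u n - 1)%N] ->
  exists2 x : R, 0 <= x < 1 & representation u x c.
Proof.
move=> arith_u c_lt cinf; have [_ u0 _] := arith_u.
pose x : R := limn (partial_sum R u c).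
have ndec := @partial_sum_nondecreasing R u c.
have cvgc : cvgn (partial_sum R u c).
  apply: nondecreasing_is_cvgn => //.
  exists (upper_sum R u c 0) => _ [n _ <-].
  exact: partial_sum_le_upper.
have cx : representation u x c by split.
exists x => //.
(* For [N = 0] the partial sum is empty and [u 0 = 1], so the interval is [0, 1). *)
have := representation_itv arith_u 0 cx.
by rewrite u0 invr1 /partial_sum big_geq// add0r.
Qed.

(** * Enumerations and blocks of sets of natural numbers *)

Lemma increasing_enumeration (A : set nat) : infinite_set A ->
  exists2 f : nat -> nat, {homo f : m n / (m < n)%N} & range f = A.
Proof.
move=> /infinite_natP Ainf.
have nextP n : exists m, `[< (n <= m)%N /\ A m >].
  by have [m nm Am] := Ainf n; exists m; apply/asboolP.
pose next n := ex_minn (nextP n).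
have next_ge n : (n <= next n)%N /\ A (next n).
  by rewrite /next; case: ex_minnP => m /asboolP.
have next_min n m : (n <= m)%N -> A m -> (next n <= m)%N.
  rewrite /next; case: ex_minnP => k _ kmin nm Am.
  by apply: kmin; apply/asboolP.
pose f k := iter k (fun n => next n.+1) (next 0).
have fS k : (f k < f k.+1)%N by have [] := next_ge (f k).+1.
have fm : {homo f : m n / (m < n)%N} by exact: homo_ltn ltn_trans fS.
exists f => //; apply/seteqP; split=> [_ [[|k] _ <-]|m Am].
- by have [] := next_ge 0.
- by have [] := next_ge (f k).+1.
have f_ge k : (k <= f k)%N.
  by elim: k => // k /leq_ltn_trans -> //.
have exk : exists k, (m <= f k)%N by exists m.
case: (ex_minnP exk) => -[|k] mk kmin.
  by exists 0 => //; apply/eqP; rewrite eqn_leq mk next_min.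
(* Since [k.+1] is the first index whose value reaches [m], [f k < m], so the element of [A]
   following [f k] is at most [m]. *)
exists k.+1 => //; apply/eqP; rewrite eqn_leq mk andbT; apply: next_min => //.
by rewrite ltnNge; apply/negP => /kmin; rewrite ltnn.
Qed.

Lemma block_end_between (S : set nat) a b : (a <= b)%N -> S a -> ~ S b ->
  exists2 r, (a <= r < b)%N & S r /\ ~ S r.+1.
Proof.
move=> + Sa; elim: b => [|b IHb] ab NSb.
  by move: ab NSb Sa; rewrite leqn0 => /eqP ->.
have [a_eq|a_le] := eqVneq a b.+1; first by rewrite a_eq in Sa.
have {}ab : (a <= b)%N by lia.
have [Sb|/IHb[//|r rab Sr]] := pselect (S b).
  by exists b => //; lia.
by exists r => //; lia.
Qed.

(** * Nested ideals and the support criterion *)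

Section ideals.
Variable I : set (set nat).
Hypotheses (freeI : free_ideal I) (transI : translation_invariant I).

Let Isub A B : A `<=` B -> I B -> I A.
Proof. by case: freeI => -[_ _ + _]; exact. Qed.

Let IU A B : I A -> I B -> I (A `|` B).
Proof. by case: freeI => -[_ + _ _]; exact. Qed.

Let Ifin A : finite_set A -> I A.
Proof. by case: freeI => _ Ifin; exact: Ifin. Qed.

Lemma ideal_preimage_addn A k : I A -> I [set n | A (n + k)%N].
Proof.
move=> /(transI (- k%:Z)); apply: Isub => n /= An.
by exists (n + k)%N => //; lia.
Qed.

Lemma ideal_image_addn A k : I A -> I ((addn^~ k) @` A).
Proof.
move=> /(transI k%:Z); apply: Isub => _ [n An <-].
by exists n.
Qed.

Lemma ideal_window A m : I A ->
  I [set n | exists2 i, (i <= m)%N & A (n + i)%N].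
Proof.
move=> IA; elim: m => [|m IHm].
  by apply: Isub IA => n [[|//] _]; rewrite addn0.
apply: Isub (IU IHm (ideal_preimage_addn m.+1 IA)) => n [i im Ani].
have [im1|im1] := eqVneq i m.+1; first by right; rewrite /= -im1.
by left; exists i => //; lia.
Qed.

(** If there are infinitely many left ends, their enumeration [l] and a right end chosen between
    consecutive ones form a left nested pair. As [0.-1 = 0], the index 0 never counts as a left
    end. *)
Lemma nested_block_starts S : nested I ->
  I [set n | S n /\ ~ S n.+1] -> I [set n | S n /\ ~ S n.-1].
Proof.
move=> nestI Iends; set L := (X in I X).
have [|Linf] := pselect (finite_set L); first exact: Ifin.
have [l lm lL] := increasing_enumeration Linf.
have lP k : S (l k) /\ ~ S (l k).-1 by rewrite -[_ /\ _]/(L (l k)) -lL; exists k.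
have rP k : exists r, [/\ (l k <= r)%N, (r < l k.+1 - 1)%N & S r /\ ~ S r.+1].
  have [Sk _] := lP k; have [_ NSk] := lP k.+1.
  have lk : (l k <= (l k.+1).-1)%N by have := lm k k.+1 (ltnSn k); lia.
  by have [r rk Sr] := block_end_between lk Sk NSk; exists r; split=> //; lia.
have [r {}rP] := choice rP.
rewrite -lL; apply: (nestI l r).
  split=> // [|k]; last by have [] := rP k.
  apply: homo_ltn ltn_trans _ => k.
  by have [_ + _] := rP k; have [+ _ _] := rP k.+1; lia.
by apply: Isub Iends => _ [k _ <-]; have [_ _] := rP k.
Qed.

Lemma nested_supp_criterion (R : realType) u :
  nested I -> arithmetic_seq u -> supp_criterion R I u.
Proof.
move=> nestI arith_u x /andP[x0 x1]; set S := supp u x.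
move=> IS [_ Ib]; have [idI _] := freeI.
have Iends : I [set n | S n /\ ~ S n.+1].
  apply: Isub (ideal_preimage_addn 1 IS) => n [Sn NSn] /=.
  by rewrite addn1; split=> //; exists n => //; lia.
have Istarts := nested_block_starts nestI Iends.
have crec := representation_recurrence arith_u
  (digits_representation arith_u x0 x1).
apply/(characterizedP _ idI x0) => e e0.
pose m := Num.bound e^-1.
have em : 1 < e * 2 ^+ m.
  by rewrite mulrC -ltr_pdivrMr// div1r upper_nthrootP.
(* Discard each [n] with a block end, a block start or a non-maximal support index among
   [n, ..., n + m.+1]. *)
apply: Isub (ideal_window m.+1 (IU (IU Iends Istarts) Ib)) => n /= en.
apply: contrapT => Nbad.
have good i : (i <= m.+1)%N -> ~ (S (n + i)%N /\ ~ S (n + i).+1) /\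
    ~ (S (n + i)%N /\ ~ S (n + i).-1) /\ ~ (S `\` supp_b u x) (n + i)%N.
  by move=> im; split; [|split] => bad_i; apply: Nbad; exists i => //;
     [left; left|left; right|right].
(* With no start or end in the window, membership in [S] is constant on [n + 1, ..., n + m]. *)
have Srun i : (i < m)%N -> S (n + i.+1)%N <-> S n.+1.
  elim: i => [|i IHi] im; first by rewrite addn1.
  have {}IHi := IHi (ltnW im).
  have [end_i _] := good i.+1 (ltnW (ltnW im)).
  have [_ [start_i _]] := good i.+2 (ltnW im).
  rewrite -IHi; rewrite !addnS /= in end_i start_i *.
  by split; apply: contraPP => ?; tauto.
have [Sn|NSn] := pselect (S n.+1).
  have := @digit_recurrence_maxs _ _ _ arith_u x0 _ n m crec.
  suff cmax i : (n < i <= n + m)%N -> digits u x i = (ratio u i - 1)%N.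
    move=> /(_ cmax); have : 0 < (2 : R) ^+ m by rewrite exprn_gt0.
    by nra.
  move=> ni; have iE : i = (n + (i - n).-1.+1)%N by lia.
  have Si : S i by rewrite iE; apply/Srun => //; lia.
  have [_ [_]] := good (i - n)%N (ltac:(lia)); rewrite subnKC; last lia.
  by move=> Nb; apply: contrapT => ci; apply: Nb; split=> // -[].
have := @digit_recurrence_zeros _ _ _ arith_u x0 _ n m crec.
suff c0 i : (n < i <= n + m)%N -> digits u x i = 0%N.
  move=> /(_ c0); have : 0 < (2 : R) ^+ m by rewrite exprn_gt0.
  by nra.
move=> ni; have iE : i = (n + (i - n).-1.+1)%N by lia.
apply: contrapT => ci; apply: NSn; apply/(Srun (i - n).-1); first lia.
by rewrite -iE; split=> //; lia.
Qed.

(* For [n = l (k + 1) - 2], the digit [n + 1] vanishes and the digit [n + 2] is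
   maximal, so [u n x] lies between [1 / (2 M)] and [1 / 2] modulo 1. *)
Lemma supp_criterion_nested (R : realType) u :
  arithmetic_seq u -> b_bounded u -> supp_criterion R I u -> nested I.
Proof.
move=> arith_u [M bM] crit l r [lm rm lr] Ir; have [idI _] := freeI.
have le_l : {homo l : m n / (m <= n)%N} by exact: ltnW_homo.
have le_r : {homo r : m n / (m <= n)%N} by exact: ltnW_homo.
pose S := [set n | exists k, (l k <= n <= r k)%N].
have gapN k n : (r k < n < l k.+1)%N -> ~ S n.
  move=> kn [j jn]; case: (leqP j k) => [/le_r|/le_l]; lia.
pose c n := if `[< S n >] then (ratio u n - 1)%N else 0%N.
have b1 n : (0 < n)%N -> (1 < ratio u n)%N.
  by case: n => // n _; exact: ratio_gt1.
have c_lt n : (0 < n)%N -> (c n < ratio u n)%N.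
  by move=> /b1; rewrite /c; case: ifP => _; lia.
have r_ge k : (k <= r k)%N.
  by elim: k => // k /leq_ltn_trans; apply; exact: rm.
have cS n : S n -> c n = (ratio u n - 1)%N by rewrite /c => /asboolP ->.
have cNS n : ~ S n -> c n = 0%N by rewrite /c => /asboolPn/negbTE ->.
have cinf : infinite_set [set n | (0 < n)%N /\ (c n < ratio u n - 1)%N].
  apply/infinite_natP => n; exists (r n).+1; first by have := r_ge n; lia.
  split=> //; rewrite cNS; first by have := b1 (r n).+1 isT; lia.
  by apply: (gapN n); have := lr n; lia.
have [x /andP[x0 x1] cx] := representation_of_digits R arith_u c_lt cinf.
have dE n : (0 < n)%N -> digits u x n = c n by exact: digits_unique.
have suppE n : supp u x n <-> (0 < n)%N /\ S n.
  split=> -[n0 Sn]; split=> //.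
    by apply: contrapT => /cNS; rewrite -dE.
  by rewrite dE// cS//; have := b1 n n0; lia.
have supp_bE : supp_b u x = supp u x.
  apply/seteqP; split=> n [n0 cn].
    by split=> //; have := b1 n n0; lia.
  have [_ Sn] : (0 < n)%N /\ S n by apply/suppE.
  by split=> //; rewrite dE// cS.
have : characterized I u (circle_pi x); first (apply: crit; first by rewrite x0).
(* A successor can leave the support only right after some [r k]. *)
- apply: Isub (ideal_image_addn 1 Ir) => n [[a /suppE[a0 [k lak]] nE] NSn].
  exists a; last by lia.
  exists k => //; apply: contrapT => ra; apply: NSn; apply/suppE.
  by split; [lia | exists k; lia].
- by rewrite supp_bE; split=> //; rewrite setDv; apply: Ifin; exact: finite_set0.
move=> /(characterizedP _ idI x0) near_half.
pose e : R := (2 * M.+1%:R)^-1.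
have e0 : 0 < e by rewrite invr_gt0 mulr_gt0// ltr0n.
(* No gap is guaranteed before [l 0], so it is put aside as a finite set; every other [l k] is an
   [n] from the set for [e], shifted by 2. *)
have := IU (Ifin (finite_set1 (l 0%N))) (ideal_image_addn 2 (near_half _ e0)).
apply: Isub => _ [[|k] _ <-]; [by left|right].
have [_ rl] := lr k; have [lr1 _] := lr k.+1.
have [n nE] : exists n, l k.+1 = n.+2 by exists (l k.+1 - 2)%N; lia.
exists n; last by rewrite nE addn2.
have crec := representation_recurrence arith_u cx.
have := crec n.+1; rewrite cS; last by exists k.+1; rewrite -nE leqnn.
have := crec n; rewrite cNS; last by apply: (gapN k); lia.
have b1_1 := ratio_gt1 arith_u n; have b1_2 := ratio_gt1 arith_u n.+1.
have bM1 := bM n.+1 isT.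
rewrite natrB 1?ltnW// add0r.
have := frac_mul_itv u n.+2 x0; have := frac_mul_itv u n.+1 x0.
have := frac_mul_itv u n x0.
have : (2 : R) <= (ratio u n.+1)%:R by rewrite ler_nat.
have : (2 : R) <= (ratio u n.+2)%:R by rewrite ler_nat.
have : (ratio u n.+1)%:R <= (M.+1%:R : R) by rewrite ler_nat; lia.
rewrite /=; move: (ratio u n.+1)%:R (ratio u n.+2)%:R => b b' bM' b'2 b2.
move=> /andP[f0 _] /andP[g0 g1] /andP[h0 _] fg gh.
(* A maximal digit gives at least [(b' - 1) / b'], which is at least 1/2; the zero digit before it
   divides this by [b], with [2 <= b <= M.+1]. *)
have half_g : 1 <= frac_mul u x n.+1 * 2 by nra.
have f_half : frac_mul u x n * 2 <= 1 by nra.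
have M2 : (2 : R) <= M.+1%:R by lra.
have e_half : e <= 2^-1.
  by rewrite lef_pV2 ?posrE ?mulr_gt0// ?ltr0n//; lra.
have e_f : e <= frac_mul u x n.
  by rewrite /e -[leLHS]div1r ler_pdivrMr ?mulr_gt0 ?ltr0n//; nra.
by rewrite /= e_f; lra.
Qed.

End ideals.

(** * Powers of 2 and the cycle of implications *)

Lemma arithmetic_seq_expn2 : arithmetic_seq (fun n => expn 2 n).
Proof.
by split=> // [m n mn|n]; [rewrite ltn_exp2l | rewrite expnS dvdn_mull].
Qed.

Lemma b_bounded_expn2 : b_bounded (fun n => expn 2 n).
Proof.
by exists 2%N => -[//|n] _; rewrite /ratio /= expnS mulnK // expn_gt0.
Qed.

Theorem theorem1p9 (R : realType) (I : set (set nat))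
    (freeI : free_ideal I) (transI : translation_invariant I) :
  [<-> nested I;
       forall u : nat -> nat, arithmetic_seq u -> supp_criterion R I u;
       forall u : nat -> nat, arithmetic_seq u -> b_bounded u ->
         supp_criterion R I u;
       supp_criterion R I (fun n => expn 2 n);
       exists u : nat -> nat,
         [/\ arithmetic_seq u, b_bounded u & supp_criterion R I u]].
Proof.
tfae.
- by move=> nestI u; exact: nested_supp_criterion.
- by move=> crit u arith_u _; exact: crit.
- by apply; [exact: arithmetic_seq_expn2 | exact: b_bounded_expn2].
- by exists (fun n => expn 2 n); split=> //;
    [exact: arithmetic_seq_expn2 | exact: b_bounded_expn2].
- by move=> [u [arith_u bu]]; exact: supp_criterion_nested.
Qed.
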